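(* The Bohl dichotomy spectrum of $x(n+1)=A(n)x(n)$, $n\in\mathbb{N}$, is the closure of its Bohl spectrum: $$\operatorname{cl}\Sigma_{\mathrm{B}}(A)=\Sigma_{\mathrm{BD}}(A).$$
   Context: Here $\mathbb{N}=\{0,1,2,\dots\}$, $d\ge 1$, and $A=(A(n))_{n\in\mathbb{N}}$ is a Lyapunov sequence: each $A(n)\in\mathbb{R}^{d\times d}$ is invertible and both $(A(n))_{n\in\mathbb{N}}$ and $(A(n)^{-1})_{n\in\mathbb{N}}$ are bounded. For $x_0\in\mathbb{R}^d$, $x(\cdot,x_0)$ denotes the solution of $x(n+1)=A(n)x(n)$ with $x(0,x_0)=x_0$; $\operatorname{cl}$ denotes closure in $\mathbb{R}$. For $x_0\neq 0$ the upper and lower Bohl exponents are $$\overline{\beta}_A(x_0)=\inf_{N\in\mathbb{N}}\ \sup_{n,m\in\mathbb{N},\,n-m>N}\frac{1}{n-m}\ln\frac{\|x(n,x_0)\|}{\|x(m,x_0)\|},\qquad \underline{\beta}_A(x_0)=\sup_{N\in\mathbb{N}}\ \inf_{n,m\in\mathbb{N},\,n-m>N}\frac{1}{n-m}\ln\frac{\|x(n,x_0)\|}{\|x(m,x_0)\|}.$$ The Bohl spectrum is $\Sigma_{\mathrm{B}}(A)=\bigcup_{x_0\in\mathbb{R}^d\setminus\{0\}}[\underline{\beta}_A(x_0),\overline{\beta}_A(x_0)]$. A system $x(n+1)=A(n)x(n)$ has a Bohl dichotomy if there exist subspaces $L_1,L_2\subseteq\mathbb{R}^d$ with $\mathbb{R}^d=L_1\oplus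 L_2$, $\alpha>0$ and functions $C_1,C_2:\mathbb{R}^d\to(0,\infty)$ such that $\|x(n,x_0)\|\le C_1(x_0)\mathrm{e}^{-\alpha(n-m)}\|x(m,x_0)\|$ for all $x_0\in L_1$, $n\ge m$, and $\|x(n,x_0)\|\ge C_2(x_0)\mathrm{e}^{\alpha(n-m)}\|x(m,x_0)\|$ for all $x_0\in L_2$, $n\ge m$ ($n,m\in\mathbb{N}$). The Bohl dichotomy spectrum is $\Sigma_{\mathrm{BD}}(A)=\{\gamma\in\mathbb{R}: x(n+1)=\mathrm{e}^{-\gamma}A(n)x(n)\text{ has no Bohl dichotomy}\}$. *)

(* Defs.v *)
From mathcomp Require Import all_boot all_order all_algebra.
From mathcomp Require Import all_classical all_reals all_analysis.
Import Order.TTheory GRing.Theory Num.Theory.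
Import numFieldNormedType.Exports.

Set Implicit Arguments.
Unset Strict Implicit.
Unset Printing Implicit Defensive.

Local Open Scope classical_set_scope.
Local Open Scope ring_scope.

(* Nonnegativity follows from these three axioms. *)
Definition is_norm (R : realType) (d : nat) (nrm : 'cV[R]_d -> R) : Prop :=
  [/\ forall x y, nrm (x + y) <= nrm x + nrm y,
      forall (a : R) x, nrm (a *: x) = `|a| * nrm x
    & forall x, nrm x = 0 -> x = 0].

(* [bounded_fun] refers to the library's entrywise maximum norm on matrices;
   in finite dimension boundedness does not depend on the norm. *)
Definition lyapunov_sequence (R : realType) (d : nat) (A : nat -> 'M[R]_d) :
    Prop :=
  [/\ forall n, A n \in unitmx,
      bounded_fun A
    & bounded_fun (fun n => invmx (A n))].

Fixpoint solution (R : realType) (d : nat) (A : nat -> 'M[R]_d)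
    (x0 : 'cV[R]_d) (n : nat) : 'cV[R]_d :=
  if n is k.+1 then A k *m solution A x0 k else x0.

(* Truncated subtraction is harmless: [N < n - m] forces [m < n].  The values
   are taken in the extended reals so that the suprema and infima below always
   have their order-theoretic meaning. *)
Definition growth_rates (R : realType) (d : nat) (nrm : 'cV[R]_d -> R)
    (A : nat -> 'M[R]_d) (x0 : 'cV[R]_d) (N : nat) : set (\bar R) :=
  [set r | exists n m : nat, (N < n - m)%N /\
     r = ((n - m)%:R^-1
            * ln (nrm (solution A x0 n) / nrm (solution A x0 m)))%:E].

Definition upper_bohl (R : realType) (d : nat) (nrm : 'cV[R]_d -> R)
    (A : nat -> 'M[R]_d) (x0 : 'cV[R]_d) : \bar R :=
  ereal_inf (range (fun N => ereal_sup (growth_rates nrm A x0 N))).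

Definition lower_bohl (R : realType) (d : nat) (nrm : 'cV[R]_d -> R)
    (A : nat -> 'M[R]_d) (x0 : 'cV[R]_d) : \bar R :=
  ereal_sup (range (fun N => ereal_inf (growth_rates nrm A x0 N))).

Definition bohl_spectrum (R : realType) (d : nat) (nrm : 'cV[R]_d -> R)
    (A : nat -> 'M[R]_d) : set R :=
  \bigcup_(x0 in [set x : 'cV[R]_d | x <> 0])
    [set g : R | (lower_bohl nrm A x0 <= g%:E <= upper_bohl nrm A x0)%E].

Definition bohl_dichotomy (R : realType) (d : nat) (nrm : 'cV[R]_d -> R)
    (A : nat -> 'M[R]_d) : Prop :=
  exists (L1 L2 : {vspace 'cV[R]_d}) (alpha : R) (C1 C2 : 'cV[R]_d -> R),
    [/\ (L1 + L2 = fullv)%VS /\ (L1 :&: L2 = 0)%VS,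
        0 < alpha,
        forall x, 0 < C1 x /\ 0 < C2 x,
        forall x0, x0 \in L1 -> forall n m : nat, (m <= n)%N ->
          nrm (solution A x0 n)
            <= C1 x0 * expR (- alpha * (n - m)%:R) * nrm (solution A x0 m)
      & forall x0, x0 \in L2 -> forall n m : nat, (m <= n)%N ->
          C2 x0 * expR (alpha * (n - m)%:R) * nrm (solution A x0 m)
            <= nrm (solution A x0 n)].

Definition bohl_dichotomy_spectrum (R : realType) (d : nat)
    (nrm : 'cV[R]_d -> R) (A : nat -> 'M[R]_d) : set R :=
  [set g : R | ~ bohl_dichotomy nrm (fun n => expR (- g) *: A n)].

(* Main.v *)
(** If the system scaled by [expR (- g)] has a Bohl dichotomy with rate [al],
    split [x0 = u + v] along it: for [v = 0] the upper Bohl exponent is at most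
    [g - al], and for [v <> 0] the growing part absorbs the decaying one, so the
    lower Bohl exponent is at least [g + al].  Every Bohl interval thus misses
    [(g - al, g + al)], with [al] independent of [x0].

    Conversely, if the Bohl spectrum misses [(g - e, g + e)], then every nonzero
    [x0] has its Bohl interval on one side of [g], and boundedness of [A] and of
    its inverse turns this into uniform decay or growth with rate [e / 2].  The
    initial values whose scaled solution decays form a subspace [L1]; any
    complement [L2] of [L1] then consists of growing solutions, because the
    constants of the dichotomy may depend on the solution. *)

Require Import Defs.
From mathcomp Require Import all_boot all_order all_algebra.
From mathcomp Require Import all_classical all_reals all_analysis.
From mathcomp Require Import ring lra.
Import Order.TTheory GRing.Theory Num.Theory.
Import numFieldNormedType.Exports.
Local Open Scope classical_set_scope.
Local Open Scope ring_scope.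

Set Implicit Arguments.
Unset Strict Implicit.
Unset Printing Implicit Defensive.

(** * Arbitrary norms on column vectors: comparison with the maximum norm and bounds for matrix
    products *)

Section Norm.
Variables (R : realType) (d : nat) (nrm : 'cV[R]_d -> R).
Hypothesis hnrm : is_norm nrm.

Let nrmD x y : nrm (x + y) <= nrm x + nrm y.
Proof. by case: hnrm. Qed.

Let nrmZ a x : nrm (a *: x) = `|a| * nrm x.
Proof. by case: hnrm. Qed.

Lemma is_norm0 : nrm 0 = 0.
Proof. by rewrite -(scale0r 0) nrmZ normr0 mul0r. Qed.

Lemma is_normN x : nrm (- x) = nrm x.
Proof. by rewrite -scaleN1r nrmZ normrN1 mul1r. Qed.

Lemma is_norm_ge0 x : 0 <= nrm x.
Proof.
by have := nrmD x (- x); rewrite subrr is_norm0 is_normN -mulr2n pmulrn_lge0.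
Qed.

Lemma is_norm_gt0 x : x != 0 -> 0 < nrm x.
Proof.
move=> x0; rewrite lt_neqAle is_norm_ge0 andbT eq_sym.
by apply: contra_neq x0; case: hnrm => _ _; exact.
Qed.

Lemma is_norm_sum I (r : seq I) (F : I -> 'cV[R]_d) :
  nrm (\sum_(i <- r) F i) <= \sum_(i <- r) nrm (F i).
Proof.
elim/big_rec2 : _ => [|i y1 y2 _ le12]; first by rewrite is_norm0.
by apply: le_trans (nrmD _ _) _; rewrite lerD2l.
Qed.

Lemma is_norm_le_coord x :
  nrm x <= \sum_i `|x i 0| * nrm (delta_mx i 0).
Proof.
rewrite {1}(matrix_sum_delta x).
under [X in nrm X]eq_bigr do rewrite big_ord1.
by apply: le_trans (is_norm_sum _ _) _; apply: ler_sum => i _; rewrite nrmZ.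
Qed.

Lemma coord_le_mx_norm m n (B : 'M[R]_(m, n)) i j : `|B i j| <= `|B|.
Proof.
rewrite [leRHS]/Num.Def.normr /= mx_normrE.
by apply/bigmax_geP; right; exists (i, j).
Qed.

Lemma is_norm_le_mx_norm : exists C, 0 < C /\ forall x, nrm x <= C * `|x^T|.
Proof.
exists (1 + \sum_i nrm (delta_mx i 0)); split.
  by rewrite ltr_pwDl// sumr_ge0// => i _; exact: is_norm_ge0.
move=> x; apply: (le_trans (is_norm_le_coord x)).
rewrite mulrDl mul1r mulr_suml; apply: ler_wpDl => //.
apply: ler_sum => i _; rewrite mulrC ler_wpM2l ?is_norm_ge0//.
by have := coord_le_mx_norm x^T 0 i; rewrite mxE.
Qed.

(** By [is_norm_le_mx_norm] the norm is Lipschitz, so it attains a minimum on the compact unit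
    sphere of the maximum norm. That minimum is positive, and its inverse is the constant.
    Transposition passes to row vectors, for which [EVT_min_rV] is stated. *)
Lemma mx_norm_le_is_norm : exists c, 0 < c /\ forall x, `|x^T| <= c * nrm x.
Proof.
have [C [C0 nrmC]] := is_norm_le_mx_norm.
pose f (y : 'rV[R]_d) := nrm y^T.
have fB y z : `|f y - f z| <= C * `|y - z|.
  have aux (u v : 'rV[R]_d) : f u - f v <= C * `|u - v|.
    rewrite lerBlDr /f; apply: le_trans (_ : nrm (u - v)^T + nrm v^T <= _).
      by apply: le_trans (nrmD _ _); rewrite linearB /= subrK.
    by rewrite lerD2r; apply: le_trans (nrmC _) _; rewrite trmxK.
  by rewrite ler_norml -normrN opprB lerNl opprB aux -normrN opprB aux.
have fcont : continuous f.
  move=> y P /nbhs_ballP[e /= e0 eP].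
  apply/nbhs_ballP; exists (e / C) => /=; first exact: divr_gt0.
  move=> z; rewrite -ball_normE /= => yz; apply: eP; rewrite -ball_normE /=.
  by apply: le_lt_trans (fB _ _) _; rewrite -ltr_pdivlMl// mulrC.
pose S := [set y : 'rV[R]_d | `|y| = 1].
have Scompact : compact S.
  apply: bounded_closed_compact.
    by exists 1; split=> // M M1 y /= ->; exact: ltW.
  have : closed (Num.Def.normr @^-1` [set r : R | r = 1] : set 'rV[R]_d).
    by apply: preimage_closed; [move=> y _; exact: norm_continuous
                               | exact: closed_eq].
  by [].
(* An empty sphere means that zero is the only vector; any positive constant then works. *)
have [[y0 Sy0]|S0] := pselect (S !=set0); last first.
  exists 1; split=> // x; have [->|x0] := eqVneq x 0.
    by rewrite trmx0 normr0 is_norm0 mulr0.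
  exfalso; apply: S0; exists (`|x^T|^-1 *: x^T) => /=.
  rewrite /S /= normrZ normfV normr_id mulVf// normr_eq0.
  by apply: contra_neq x0 => /(congr1 trmx); rewrite trmxK trmx0.
have [||c cS cmin] := @EVT_min_rV R d f S _ Scompact; first by exists y0.
  exact: continuous_subspaceT.
have fc0 : 0 < f c.
  apply: is_norm_gt0; apply/eqP => /(congr1 trmx); rewrite trmxK trmx0 => c0.
  by move: cS; rewrite inE /S /= c0 normr0 => /esym/eqP; rewrite oner_eq0.
exists (f c)^-1; split; first by rewrite invr_gt0.
move=> x; have [->|x0] := eqVneq x 0.
  by rewrite trmx0 normr0 is_norm0 mulr0.
have xT0 : 0 < `|x^T|.
  rewrite normr_gt0.
  by apply: contra_neq x0 => /(congr1 trmx); rewrite trmxK trmx0.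
have /cmin : `|x^T|^-1 *: x^T \in S.
  by rewrite inE /S /= normrZ normfV normr_id mulVf// gt_eqF.
rewrite {2}/f linearZ /= trmxK nrmZ normfV normr_id => h.
by rewrite ler_pdivlMl// mulrC -ler_pdivlMl.
Qed.

(** Applied to [A] and to its inverse, this controls how much a solution changes in one time step.
    The summand 1 in the witness secures [1 <= K], so that powers of [K] do not decrease with the
    exponent. *)
Lemma bounded_mulmx_is_norm (B : nat -> 'M[R]_d) : bounded_fun B ->
  exists K, 1 <= K /\ forall n x, nrm (B n *m x) <= K * nrm x.
Proof.
move=> [M' [_ BM']]; pose M := M' + 1.
have BM n : `|B n| <= M by apply: BM' => //; rewrite ltrDl.
have M0 : 0 <= M by apply: le_trans (BM 0).
have [c [c0 hc]] := mx_norm_le_is_norm.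
pose D := \sum_(i < d) nrm (delta_mx i 0).
have D0 : 0 <= D by apply: sumr_ge0 => i _; exact: is_norm_ge0.
have DM0 : 0 <= M * d%:R * c * D by rewrite !mulr_ge0 // ltW.
exists (1 + M * d%:R * c * D); split; first by rewrite lerDl.
move=> n x; apply: (le_trans (is_norm_le_coord _)).
rewrite mulrDl mul1r ler_wpDl ?is_norm_ge0//.
rewrite (_ : _ * nrm x = D * (M * d%:R * (c * nrm x))); last by ring.
rewrite [leRHS]mulr_suml; apply: ler_sum => i _.
rewrite mulrC ler_wpM2l ?is_norm_ge0// mxE.
apply: le_trans (ler_norm_sum _ _ _) _.
apply: le_trans (_ : \sum_(j < d) M * (c * nrm x) <= _); last first.
  by rewrite sumr_const card_ord -[leLHS]mulr_natr mulrAC.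
apply: ler_sum => j _; rewrite normrM ler_pM//.
  by apply: le_trans (BM n); exact: coord_le_mx_norm.
by apply: le_trans (hc x); have := coord_le_mx_norm x^T 0 j; rewrite mxE.
Qed.

End Norm.

(** * Subspaces cut out by predicates stable under linear combinations *)

Section Vspace.
Variables (K : fieldType) (V : vectType K) (P : V -> Prop).
Hypotheses (P0 : P 0) (Plin : forall a u v, P u -> P v -> P (a *: u + v)).

(** Take [L] of largest dimension among the subspaces on which [P] holds. If [P x], then [P] still
    holds on the sum of [L] and the line through [x]; by maximality the dimension does not grow, so
    [x] is in [L]. *)
Lemma exists_vspace_of_linear_closed :
  exists L : {vspace V}, forall x, x \in L <-> P x.
Proof.
pose Q (L : {vspace V}) := forall x, x \in L -> P x.
pose D := [pred k : nat | `[< exists2 L, Q L & \dim L = k >] ].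
have exD : exists k, D k.
  by exists 0%N; apply/asboolP; exists 0%VS;
    [move=> x; rewrite memv0 => /eqP -> | exact: dimv0].
have Dbound k : D k -> (k <= \dim {:V})%N.
  by move=> /asboolP[L _ <-]; rewrite dimvS// subvf.
case: (ex_maxnP exD Dbound) => k /asboolP[L LP dimL] kmax.
exists L => x; split; first exact: LP.
move=> Px; have QLx : Q (L + <[x]>)%VS.
  move=> _ /memv_addP[u /LP Pu [v /vlineP[a ->] ->]].
  by rewrite addrC; apply: Plin.
have /kmax : D (\dim (L + <[x]>)) by apply/asboolP; exists (L + <[x]>)%VS.
rewrite -dimL (geq_leqif (dimv_leqif_sup (addvSl L <[x]>))) => /subvP; apply.
by rewrite memvE addvSr.
Qed.

End Vspace.

(** * Logarithmic rates and exponential estimates for real sequences *)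

Section GrowthOfSequences.
Variable R : realType.
Implicit Types (a b C K M : R) (X : nat -> R).

Lemma mean_log_le a k (u v : R) : (0 < k)%N -> 0 < u -> 0 < v ->
  (k%:R^-1 * ln (u / v) <= a) = (u <= expR (a * k%:R) * v).
Proof.
move=> k0 u0 v0; rewrite ler_pdivrMl ?ltr0n// [leRHS]mulrC -[leRHS]expRK.
by rewrite ler_ln ?posrE ?expR_gt0 ?divr_gt0// ler_pdivrMr.
Qed.

Lemma mean_log_ge a k (u v : R) : (0 < k)%N -> 0 < u -> 0 < v ->
  (a <= k%:R^-1 * ln (u / v)) = (expR (a * k%:R) * v <= u).
Proof.
move=> k0 u0 v0; rewrite ler_pdivlMl ?ltr0n// [leLHS]mulrC -[leLHS]expRK.
by rewrite ler_ln ?posrE ?expR_gt0 ?divr_gt0// ler_pdivlMr.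
Qed.

(** A consequence of [1 + y <= expR y]. Over long time spans it absorbs a multiplicative constant
    into an arbitrarily small change of the exponential rate. *)
Lemma exists_le_expR C a : 0 < a ->
  exists N, forall n, (N < n)%N -> C <= expR (a * n%:R).
Proof.
move=> a0; exists (Num.truncn (C / a)).+1 => n Nn.
apply: le_trans (_ : a * n%:R <= _); last first.
  by apply: le_trans (expR_ge1Dx _); rewrite lerDr.
rewrite mulrC -ler_pdivrMr//; apply: le_trans (ltW (truncnS_gt _)) _.
by rewrite ler_nat ltnW.
Qed.

Lemma le_step_iter X K : 0 <= K -> (forall n, X n.+1 <= K * X n) ->
  forall m n, (m <= n)%N -> X n <= K ^+ (n - m) * X m.
Proof.
move=> K0 XK m n /subnK <-; rewrite addnK; elim: (n - m)%N => [|j IH].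
  by rewrite expr0 mul1r.
by rewrite addSn exprS -mulrA; apply: le_trans (XK _) _; rewrite ler_wpM2l.
Qed.

Lemma step_iter_le X K : 0 <= K -> (forall n, X n <= K * X n.+1) ->
  forall m n, (m <= n)%N -> X m <= K ^+ (n - m) * X n.
Proof.
move=> K0 XK m n /subnK <-; rewrite addnK; elim: (n - m)%N => [|j IH].
  by rewrite expr0 mul1r.
rewrite addSn; apply: le_trans IH _.
by rewrite exprSr -mulrA ler_wpM2l ?exprn_ge0.
Qed.

(* Covers the finitely many short time spans [j <= N] that Bohl exponents
   ignore. *)
Lemma le_exp_fill K b (u v : R) j N : 1 <= K -> 0 <= u -> 0 <= v ->
  (j <= N)%N -> u <= K ^+ j * v ->
  expR (b * j%:R) * u <= (K * expR `|b|) ^+ N * v.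
Proof.
move=> K1 u0 v0 jN uv.
apply: le_trans (_ : expR (b * j%:R) * (K ^+ j * v) <= _).
  by rewrite ler_wpM2l ?expR_ge0.
rewrite mulrA ler_wpM2r// mulrC expRM_natr -exprMn.
have Kb1 : 1 <= K * expR `|b|.
  by rewrite mulr_ege1// -[leLHS]expR0 ler_expR.
apply: le_trans (_ : (K * expR `|b|) ^+ j <= _); last exact: ler_weXn2l.
rewrite lerXn2r ?nnegrE ?mulr_ge0 ?expR_ge0 ?(le_trans ler01)//.
by rewrite ler_wpM2l ?(le_trans ler01)// ler_expR ler_norm.
Qed.

End GrowthOfSequences.

(** * Bohl exponents of a single solution versus its exponential estimates *)

Section BohlExponents.
Variables (R : realType) (d : nat) (nrm : 'cV[R]_d -> R) (A : nat -> 'M[R]_d).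
Variable x0 : 'cV[R]_d.
Local Notation X n := (nrm (solution A x0 n)).
Hypothesis X0 : forall n, 0 < X n.

(** A rate over a span longer than both [N] and [N'] lies above the infimum for [N] and below the
    supremum for [N']. *)
Lemma lower_le_upper_bohl :
  (lower_bohl nrm A x0 <= upper_bohl nrm A x0)%E.
Proof.
apply: ge_ereal_sup => _ [N _ <-]; apply: le_ereal_inf_tmp => _ [N' _ <-].
pose k := (maxn N N').+1.
pose r := ((k - 0)%:R^-1 * ln (X k / X 0))%:E.
apply: (@le_trans _ _ r).
  apply: ereal_inf_lbound; exists k, 0%N; split=> //.
  by rewrite subn0 ltnS leq_maxl.
apply: ereal_sup_ubound; exists k, 0%N; split=> //.
by rewrite subn0 ltnS leq_maxr.
Qed.

(** For each [e > 0], long spans satisfy [C <= expR (e * (n - m))], so the constant costs only [e]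
    in the rate. *)
Lemma upper_bohl_le (a C : R) N : 0 < C ->
  (forall m n, (N < n - m)%N -> X n <= C * expR (a * (n - m)%:R) * X m) ->
  (upper_bohl nrm A x0 <= a%:E)%E.
Proof.
move=> C0 XC; apply/lee_addgt0Pr => e e0.
have [N' CN'] := exists_le_expR C e0.
apply: le_trans (ereal_inf_lbound _ ) _; first by exists (maxn N N').
apply: ge_ereal_sup => _ [n [m [Nnm ->]]].
move: Nnm; rewrite gtn_max => /andP[Nnm N'nm].
rewrite -EFinD lee_fin mean_log_le ?(leq_trans _ Nnm)//.
apply: le_trans (XC _ _ Nnm) _; rewrite ler_pM2r// mulrDl expRD mulrC.
by rewrite ler_pM2l ?expR_gt0 ?CN'.
Qed.

Lemma lower_bohl_ge (a C : R) N : 0 < C ->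
  (forall m n, (N < n - m)%N -> C * expR (a * (n - m)%:R) * X m <= X n) ->
  (a%:E <= lower_bohl nrm A x0)%E.
Proof.
move=> C0 XC; apply/lee_subgt0Pr => e e0.
have [N' CN'] := exists_le_expR C^-1 e0.
apply: le_trans (ereal_sup_ubound _ ); last by exists (maxn N N').
apply: le_ereal_inf_tmp => _ [n [m [Nnm ->]]].
move: Nnm; rewrite gtn_max => /andP[Nnm N'nm].
rewrite -EFinB lee_fin mean_log_ge ?(leq_trans _ Nnm)//.
apply: le_trans (XC _ _ Nnm); rewrite ler_pM2r// mulrBl expRD expRN mulrC.
rewrite ler_pM2r ?expR_gt0// -[leRHS]invrK lef_pV2 ?posrE ?invr_gt0 ?expR_gt0//.
exact: CN'.
Qed.

(** The strict inequality yields an [N] such that all spans longer than [N] satisfy the estimate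
    with constant 1. Shorter spans are handled by the one-step bound [K], at the cost of the
    constant [M ^+ N]. *)
Lemma upper_bohl_lt (a K : R) : 1 <= K -> (forall n, X n.+1 <= K * X n) ->
  (upper_bohl nrm A x0 < a%:E)%E ->
  exists C, 0 < C /\ forall m n, (m <= n)%N ->
    X n <= C * expR (a * (n - m)%:R) * X m.
Proof.
move=> K1 XK /ereal_inf_lt[_ [N _ <-]] supa.
pose M := K * expR `|- a|.
have K0 : 0 < K by apply: lt_le_trans K1.
have M1 : 1 <= M by rewrite mulr_ege1// -[leLHS]expR0 ler_expR.
exists (M ^+ N); split; first by rewrite exprn_gt0// (lt_le_trans _ M1).
move=> m n mn; have [nmN|Nnm] := leqP (n - m) N.
  have := le_exp_fill (- a) K1 (ltW (X0 n)) (ltW (X0 m)) nmN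
    (le_step_iter (ltW K0) XK mn).
  by rewrite mulNr expRN ler_pdivrMl ?expR_gt0// mulrCA mulrA.
have : (((n - m)%:R^-1 * ln (X n / X m))%:E <= a%:E)%E.
  by apply: le_trans (ltW supa); apply: ereal_sup_ubound; exists n, m.
rewrite lee_fin mean_log_le ?(leq_trans _ Nnm)// => /le_trans; apply.
by rewrite ler_pM2r// ler_peMl ?expR_ge0// exprn_ege1.
Qed.

(** As for [upper_bohl_lt], but the one-step bound now runs backwards: over a short span the
    solution cannot shrink by more than a factor [K] per step. *)
Lemma lower_bohl_gt (a K : R) : 1 <= K -> (forall n, X n <= K * X n.+1) ->
  (a%:E < lower_bohl nrm A x0)%E ->
  exists C, 0 < C /\ forall m n, (m <= n)%N ->
    C * expR (a * (n - m)%:R) * X m <= X n.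
Proof.
move=> K1 XK /ereal_sup_gt[_ [N _ <-]] infa.
pose M := K * expR `|a|.
have K0 : 0 < K by apply: lt_le_trans K1.
have M1 : 1 <= M by rewrite mulr_ege1// -[leLHS]expR0 ler_expR.
have MN1 : 1 <= M ^+ N by rewrite exprn_ege1.
have MN0 : 0 < M ^+ N by apply: lt_le_trans MN1.
exists (M ^+ N)^-1; split; first by rewrite invr_gt0.
move=> m n mn; have [nmN|Nnm] := leqP (n - m) N.
  have := le_exp_fill a K1 (ltW (X0 m)) (ltW (X0 n)) nmN
    (step_iter_le (ltW K0) XK mn).
  by rewrite -mulrA ler_pdivrMl.
have : (a%:E <= ((n - m)%:R^-1 * ln (X n / X m))%:E)%E.
  by apply: le_trans (ltW infa) _; apply: ereal_inf_lbound; exists n, m.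
rewrite lee_fin mean_log_ge ?(leq_trans _ Nnm)//; apply: le_trans.
by rewrite ler_pM2r// ler_piMl ?expR_ge0// invf_le1.
Qed.

End BohlExponents.

(** * Dichotomies of the scaled systems and gaps in the Bohl spectrum *)

Section Dichotomy.
Variables (R : realType) (d : nat) (nrm : 'cV[R]_d -> R) (A : nat -> 'M[R]_d).
Hypothesis hnrm : is_norm nrm.
Implicit Types (u v x : 'cV[R]_d) (g a b c : R).
Local Notation X x n := (nrm (solution A x n)).

Lemma solution_linear a u v n :
  solution A (a *: u + v) n = a *: solution A u n + solution A v n.
Proof. by elim: n => //= n ->; rewrite mulmxDr scalemxAr. Qed.

Lemma solutionD u v n : solution A (u + v) n = solution A u n + solution A v n.
Proof. by rewrite -[u in LHS]scale1r solution_linear scale1r. Qed.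

Lemma solution0 n : solution A 0 n = 0.
Proof. by elim: n => //= n ->; rewrite mulmx0. Qed.

Lemma norm_solution_expR_scale g x n :
  nrm (solution (fun k => expR (- g) *: A k) x n) = expR (- g * n%:R) * X x n.
Proof.
have -> : solution (fun k => expR (- g) *: A k) x n =
    expR (- g * n%:R) *: solution A x n.
  elim: n => [|n /= ->]; first by rewrite mulr0 expR0 scale1r.
  rewrite -scalemxAl -scalemxAr scalerA -expRD.
  by congr (expR _ *: _); rewrite -natr1; ring.
by case: hnrm => _ -> _; rewrite ger0_norm ?expR_ge0.
Qed.

Lemma expR_scaled_le g a c x m n : (m <= n)%N ->
  (nrm (solution (fun k => expR (- g) *: A k) x n) <=
     c * expR (a * (n - m)%:R) * nrm (solution (fun k => expR (- g) *: A k) x m))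
  = (X x n <= c * expR ((g + a) * (n - m)%:R) * X x m).
Proof.
move=> mn; rewrite !norm_solution_expR_scale !mulNr !expRN.
rewrite ler_pdivrMl ?expR_gt0//; congr (_ <= _).
have -> : n%:R = (n - m)%:R + m%:R :> R by rewrite -natrD subnK.
rewrite mulrDl mulrDr !expRD.
by field; rewrite gt_eqF ?expR_gt0.
Qed.

Lemma expR_scaled_ge g a c x m n : (m <= n)%N ->
  (c * expR (a * (n - m)%:R) * nrm (solution (fun k => expR (- g) *: A k) x m)
     <= nrm (solution (fun k => expR (- g) *: A k) x n))
  = (c * expR ((g + a) * (n - m)%:R) * X x m <= X x n).
Proof.
move=> mn; rewrite !norm_solution_expR_scale !mulNr !expRN.
rewrite [leRHS]mulrC ler_pdivlMr ?expR_gt0//; congr (_ <= _).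
have -> : n%:R = (n - m)%:R + m%:R :> R by rewrite -natrD subnK.
rewrite mulrDl mulrDr !expRD.
by field; rewrite gt_eqF ?expR_gt0.
Qed.

(** Undoing the scaling shifts the rates [- al] and [al] by [g]. The functions [C1] and [C2] become
    a separate constant for each solution, recovered by choice in the converse, with value 1 outside
    the subspace concerned. *)
Lemma bohl_dichotomy_scaledP g :
  bohl_dichotomy nrm (fun n => expR (- g) *: A n) <->
  exists (L1 L2 : {vspace 'cV[R]_d}) (al : R),
    [/\ (L1 + L2 = fullv)%VS /\ (L1 :&: L2 = 0)%VS, 0 < al,
      forall x, x \in L1 -> exists C, 0 < C /\ forall m n, (m <= n)%N ->
        X x n <= C * expR ((g - al) * (n - m)%:R) * X x m
    & forall x, x \in L2 -> exists C, 0 < C /\ forall m n, (m <= n)%N ->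
        C * expR ((g + al) * (n - m)%:R) * X x m <= X x n].
Proof.
split=> [[L1 [L2 [al [C1 [C2 [L12 al0 C0 h1 h2]]]]]]|
         [L1 [L2 [al [L12 al0 h1 h2]]]]]; exists L1, L2, al.
  split=> // x xL; [exists (C1 x) | exists (C2 x)]; split; try by case: (C0 x).
  - by move=> m n mn; rewrite -expR_scaled_le// h1.
  - by move=> m n mn; rewrite -expR_scaled_ge// h2.
have /choice[C1 hC1] x : exists C, 0 < C /\ (x \in L1 ->
    forall m n, (m <= n)%N ->
      X x n <= C * expR ((g - al) * (n - m)%:R) * X x m).
  have [/h1[C [C0 hC]]|_] := boolP (x \in L1); first by exists C.
  by exists 1.
have /choice[C2 hC2] x : exists C, 0 < C /\ (x \in L2 ->
    forall m n, (m <= n)%N ->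
      C * expR ((g + al) * (n - m)%:R) * X x m <= X x n).
  have [/h2[C [C0 hC]]|_] := boolP (x \in L2); first by exists C.
  by exists 1.
exists C1, C2; split=> //.
- by move=> x; split; [case: (hC1 x) | case: (hC2 x)].
- by move=> x xL n m mn; rewrite expR_scaled_le//; case: (hC1 x) => _; apply.
- by move=> x xL n m mn; rewrite expR_scaled_ge//; case: (hC2 x) => _; apply.
Qed.

Hypothesis Aunit : forall n, A n \in unitmx.

Lemma norm_solution_gt0 x n : x != 0 -> 0 < X x n.
Proof.
move=> x0; apply: is_norm_gt0 => //; elim: n => //= n; apply: contra_neq.
by move=> /(congr1 (mulmx (invmx (A n)))); rewrite mulKmx// mulmx0.
Qed.

(* The estimate is asserted only for [n - m] large: this forces [n] to be large,
   so that the growing part already dominates at time [n]. *)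
Lemma growth_add_decay g al u v (C1 C2 : R) : 0 < al -> v != 0 ->
  0 < C1 -> 0 < C2 ->
  (forall m n, (m <= n)%N ->
     X u n <= C1 * expR ((g - al) * (n - m)%:R) * X u m) ->
  (forall m n, (m <= n)%N ->
     C2 * expR ((g + al) * (n - m)%:R) * X v m <= X v n) ->
  exists C N, 0 < C /\ forall m n, (N < n - m)%N ->
    C * expR ((g + al) * (n - m)%:R) * X (u + v) m <= X (u + v) n.
Proof.
move=> al0 v0 C10 C20 hu hv.
have V0 n : 0 < X v n by exact: norm_solution_gt0.
have U0 n : 0 <= X u n by exact: is_norm_ge0.
(* Comparing both estimates from time 0 shows that the ratio of [X u n] to [X v n] is at most
   [q * expR (- (2 * al) * n)]. *)
pose q := C1 * X u 0 / (C2 * X v 0).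
have q0 : 0 <= q by rewrite divr_ge0 ?mulr_ge0 // ltW.
have uv n : X u n * expR ((2 * al) * n%:R) <= q * X v n.
  have hu0 := hu 0%N n (leq0n n); have hv0 := hv 0%N n (leq0n n).
  rewrite !subn0 in hu0 hv0.
  apply: le_trans (_ : q * (C2 * expR ((g + al) * n%:R) * X v 0) <= _).
    rewrite (_ : q * _ = C1 * expR ((g - al) * n%:R) * X u 0
                         * expR (2 * al * n%:R)).
      by rewrite ler_pM2r ?expR_gt0.
    rewrite (_ : (g + al) * _ = (g - al) * n%:R + 2 * al * n%:R); last by ring.
    by rewrite expRD /q; field; rewrite !gt_eqF.
  by rewrite ler_wpM2l.
have uqv n : X u n <= q * X v n.
  apply: le_trans (uv n); rewrite ler_peMr// -[leLHS]expR0 ler_expR.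
  by rewrite !mulr_ge0 // ltW.
(* After time [N] the part [u] has at most half the norm of [v], so [u + v] retains at least half of
   it. *)
have [N hN] := exists_le_expR (2 * q) (mulr_gt0 (ltr0n R 2) al0).
have uv2 n : (N < n)%N -> 2 * X u n <= X v n.
  move=> /hN; have := uv n; set e := expR _ => ue eq2.
  have e0 : 0 < e by exact: expR_gt0.
  rewrite -(ler_pM2r e0) -mulrA; apply: le_trans (_ : 2 * (q * X v n) <= _).
    by rewrite ler_pM2l.
  by rewrite mulrA [leRHS]mulrC ler_pM2r.
(* The factor [1 + q] comes from bounding [u + v] by [v] at time [m], the factor 2 from bounding [v]
   by [u + v] at time [n]. *)
exists (C2 / (2 * (1 + q))), N; split; first by rewrite divr_gt0// mulr_gt0// ltr_wpDr.
move=> m n Nnm; have mn : (m <= n)%N by rewrite ltnW// -subn_gt0 (leq_trans _ Nnm).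
have Nn : (N < n)%N by apply: leq_trans Nnm _; exact: leq_subr.
have Xm : X (u + v) m <= (1 + q) * X v m.
  rewrite solutionD; have [tri _ _] := hnrm; apply: le_trans (tri _ _) _.
  by have := uqv m; rewrite mulrDl mul1r addrC lerD2l.
have Xn : X v n <= 2 * X (u + v) n.
  have : X v n <= X (u + v) n + X u n.
    have [tri _ _] := hnrm; have := tri (solution A (u + v) n) (- solution A u n).
    by rewrite is_normN// solutionD addrAC subrr add0r.
  by have := uv2 n Nn; lra.
have E0 : 0 < expR ((g + al) * (n - m)%:R) by exact: expR_gt0.
have q10 : 0 < 1 + q by rewrite ltr_wpDr.
rewrite -(ler_pM2l (ltr0n R 2)); apply: le_trans Xn.
apply: le_trans (hv m n mn).
rewrite [leLHS](_ : _ = C2 * expR ((g + al) * (n - m)%:R) * (X (u + v) m / (1 + q))).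
  by rewrite ler_pM2l ?mulr_gt0// ler_pdivrMr// mulrC.
by field; rewrite gt_eqF.
Qed.

Lemma bohl_spectrum_dichotomy_gap g :
  bohl_dichotomy nrm (fun n => expR (- g) *: A n) ->
  exists al, 0 < al /\ forall h, `|g - h| < al -> ~ bohl_spectrum nrm A h.
Proof.
move=> /bohl_dichotomy_scaledP[L1 [L2 [al [[L12 _] al0 h1 h2]]]].
exists al; split=> // h gh [x /= /eqP x0 /andP[lox upx]].
have X0 n := norm_solution_gt0 n x0.
have /memv_addP[u uL [v vL xuv]] : x \in (L1 + L2)%VS by rewrite L12 memvf.
have [C1 [C10 hu]] := h1 u uL; have [C2 [C20 hv]] := h2 v vL.
move: gh; rewrite ltr_norml => /andP[gh1 gh2].
have [v0|v0] := eqVneq v 0.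
  have xu : x = u by rewrite xuv v0 addr0.
  have : (upper_bohl nrm A x <= (g - al)%:E)%E.
    apply: (@upper_bohl_le _ _ _ _ _ X0 _ C1 0%N) => // m n mn.
    by rewrite xu; apply: hu; rewrite ltnW// -subn_gt0.
  move=> /(le_trans upx); rewrite lee_fin; lra.
have [C [N [C0 hx]]] := growth_add_decay al0 v0 C10 C20 hu hv.
have : ((g + al)%:E <= lower_bohl nrm A x)%E.
  by rewrite xuv; apply: (@lower_bohl_ge _ _ _ _ _ _ _ C N); rewrite -?xuv// xuv.
move=> /le_trans/(_ lox); rewrite lee_fin; lra.
Qed.

(** Otherwise the Bohl interval meets the gap. Either it contains [g], or its endpoint nearer to [g]
    lies within [e] of [g]; that endpoint is then finite and belongs to the interval. *)
Lemma bohl_interval_side x g e : 0 < e -> x != 0 ->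
  (forall h, `|g - h| < e -> ~ bohl_spectrum nrm A h) ->
  (upper_bohl nrm A x <= (g - e)%:E)%E \/ ((g + e)%:E <= lower_bohl nrm A x)%E.
Proof.
move=> e0 x0 gap; have X0 n := norm_solution_gt0 n x0.
have lu := lower_le_upper_bohl nrm A x.
have {}gap h : `|g - h| < e ->
    ~ (lower_bohl nrm A x <= h%:E <= upper_bohl nrm A x)%E.
  by move=> /gap gh lhu; apply: gh; exists x => //=; exact/eqP.
have [up|up] := leP (upper_bohl nrm A x) (g - e)%:E; first by left.
have [lo|lo] := leP (g + e)%:E (lower_bohl nrm A x); first by right.
exfalso; have gup : (lower_bohl nrm A x <= g%:E)%E ->
    (upper_bohl nrm A x < g%:E)%E.
  move=> lg; rewrite ltNge; apply/negP => gu; apply: (gap g).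
    by rewrite subrr normr0.
  by rewrite lg.
have [lg|gl] := leP (lower_bohl nrm A x) g%:E.
  have ug := gup lg; move: lu up ug (gap).
  case: (upper_bohl nrm A x) => [p| |] //= lp; rewrite !lte_fin => ep pg.
  by move/(_ p); apply; rewrite ?lp ?lexx// ltr_norml; apply/andP; split; lra.
move: lu lo gl gap; case: (lower_bohl nrm A x) => [l| |] //= lp.
rewrite !lte_fin => le gl /(_ l); apply; rewrite ?lp ?lexx//.
by rewrite ltr_norml; apply/andP; split; lra.
Qed.

Lemma spectrum_gap_bohl_dichotomy g e K : 0 < e -> 1 <= K ->
  (forall n x, nrm (A n *m x) <= K * nrm x) ->
  (forall n x, nrm x <= K * nrm (A n *m x)) ->
  (forall h, `|g - h| < e -> ~ bohl_spectrum nrm A h) ->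
  bohl_dichotomy nrm (fun n => expR (- g) *: A n).
Proof.
move=> e0 K1 AK KA gap; apply/bohl_dichotomy_scaledP.
(* Any rate strictly between 0 and [e] would do: [upper_bohl_lt] and [lower_bohl_gt] need strict
   inequalities. *)
pose al := e / 2; have al0 : 0 < al by exact: divr_gt0.
(* Decay is measured from time 0 only, which makes the condition visibly stable under linear
   combinations. The estimate between arbitrary times is recovered below from [decay]. *)
pose stable x := exists C, forall n, X x n <= C * expR ((g - al) * n%:R).
have [||L1 L1P] := @exists_vspace_of_linear_closed _ _ stable.
- by exists 0 => n; rewrite solution0 is_norm0// mul0r.
- move=> a u v [C1 h1] [C2 h2]; exists (`|a| * C1 + C2) => n.
  have [tri scale _] := hnrm; rewrite solution_linear.
  apply: le_trans (tri _ _) _; rewrite scale mulrDl lerD// -mulrA.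
  by rewrite ler_wpM2l.
have decay x : x != 0 -> (upper_bohl nrm A x <= (g - e)%:E)%E ->
    exists C, 0 < C /\ forall m n, (m <= n)%N ->
      X x n <= C * expR ((g - al) * (n - m)%:R) * X x m.
  move=> x0 ux; apply: (upper_bohl_lt _ K1) => //.
  - by move=> n; exact: norm_solution_gt0.
  - by move=> n; exact: AK.
  - by apply: (le_lt_trans ux); rewrite lte_fin /al; lra.
have growth x : x != 0 -> ((g + e)%:E <= lower_bohl nrm A x)%E ->
    exists C, 0 < C /\ forall m n, (m <= n)%N ->
      C * expR ((g + al) * (n - m)%:R) * X x m <= X x n.
  move=> x0 lx; apply: (lower_bohl_gt _ K1) => //.
  - by move=> n; exact: norm_solution_gt0.
  - by move=> n; exact: KA.
  - by apply: lt_le_trans lx; rewrite lte_fin /al; lra.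
exists L1, (L1^C)%VS, al; split=> //.
- by rewrite addv_complf capv_compl.
- move=> x /L1P[C hC]; have [->|x0] := eqVneq x 0.
    by exists 1; split=> // m n _; rewrite !solution0 is_norm0// mulr0.
  have [|/(growth _ x0)[c [c0 hc]]] := bohl_interval_side e0 x0 gap.
    exact: decay.
  have Xx : 0 < X x 0 by exact: norm_solution_gt0.
  (* A solution that is stable and growing would keep [expR (2 * al * n)] below [C / (c * X x 0)]
     for all [n]; time [N.+1] refutes this. *)
  have [N hN] := exists_le_expR (C / (c * X x 0) + 1) (mulr_gt0 (ltr0n R 2) al0).
  have := hN _ (ltnSn N); have := le_trans (hc 0%N N.+1 (leq0n _)) (hC N.+1).
  rewrite subn0.
  rewrite (_ : (g + al) * _ = (g - al) * N.+1%:R + 2 * al * N.+1%:R); last by ring.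
  rewrite expRD; set E := expR (2 * al * _); rewrite [c * _]mulrCA -mulrA.
  rewrite [leRHS]mulrC ler_pM2l ?expR_gt0// -mulrA mulrCA => hE1 hE2.
  have : E <= C / (c * X x 0) by rewrite ler_pdivlMr// mulr_gt0.
  by move: hE2; lra.
- move=> x xL2; have [->|x0] := eqVneq x 0.
    by exists 1; split=> // m n _; rewrite !solution0 is_norm0// mulr0.
  (* A nonzero decaying [x] would be stable, hence in [L1], which meets its complement only in 0. *)
  have [/(decay _ x0)[C [C0 hC]]|] := bohl_interval_side e0 x0 gap; last first.
    exact: growth.
  have xL1 : x \in L1.
    apply/L1P; exists (C * X x 0) => n; rewrite mulrAC.
    by have := hC 0%N n (leq0n n); rewrite subn0.
  have : x \in (L1 :&: L1^C)%VS by rewrite memv_cap xL1 xL2.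
  by rewrite capv_compl memv0 (negPf x0).
Qed.

End Dichotomy.

Theorem theorem27 (R : realType) (d : nat) (hd : (0 < d)%N)
    (nrm : 'cV[R]_d -> R) (hnrm : is_norm nrm)
    (A : nat -> 'M[R]_d) (hA : lyapunov_sequence A) :
  closure (bohl_spectrum nrm A) = bohl_dichotomy_spectrum nrm A.
Proof.
have [Aunit Abnd Ainvbnd] := hA.
have [K1 [K11 hK1]] := bounded_mulmx_is_norm hnrm Abnd.
have [K2 [K21 hK2]] := bounded_mulmx_is_norm hnrm Ainvbnd.
(* One constant bounds a step in both directions; the backward bound [KA] writes [x] as the inverse
   of [A n] applied to [A n *m x]. *)
pose K := Num.max K1 K2.
have K_ge1 : 1 <= K by rewrite le_max K11.
have AK n x : nrm (A n *m x) <= K * nrm x.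
  by apply: le_trans (hK1 n x) _; rewrite ler_wpM2r ?is_norm_ge0// le_max lexx.
have KA n x : nrm x <= K * nrm (A n *m x).
  rewrite -{1}(mulKmx (Aunit n) x); apply: le_trans (hK2 n _) _.
  by rewrite ler_wpM2r ?is_norm_ge0// le_max lexx orbT.
rewrite eqEsubset; split=> g.
  move=> clg /(bohl_spectrum_dichotomy_gap hnrm Aunit)[al [al0 gap]].
  have [h [Sh]] := clg _ (nbhsx_ballx g al al0).
  by rewrite -ball_normE => /gap; apply.
(* If the neighbourhood [B] of [g] missed the spectrum, the ball of radius [e] inside it would be a
   gap and give a dichotomy. *)
move=> nodich B /nbhs_ballP[e /= e0 eB].
have [//|SB0] := pselect (bohl_spectrum nrm A `&` B !=set0).
exfalso; apply: nodich.
apply: (spectrum_gap_bohl_dichotomy hnrm Aunit e0 K_ge1 AK KA) => h gh Sh.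
by apply: SB0; exists h; split=> //; apply: eB; rewrite -ball_normE.
Qed.
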